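(* Let $S$ be a finite nonempty data set of creatures, each having a species (elf or ogre) and a salary (low, medium or high), labeled as follows: a creature with low salary is not creditworthy, a creature with high salary is creditworthy, and a creature with medium salary is creditworthy if and only if it is an elf. Let $p_0,p_5,p_{10}\ge 0$, $p_0+p_5+p_{10}=1$, be the fractions of creatures in $S$ with low, medium and high salary, respectively. Suppose that the advantaged group (elves) and the disadvantaged group (ogres) are of the same size, and that the attribute values (species and salary) are independent of each other in $S$. Then up to $50\%$ of all data points can have a medium salary and the decision tree will not ask for the sensitive attribute ''species'' in the first level of the tree; that is, if $p_5\le\tfrac12$, then the binary decision tree built from $S$ with the Gini criterion described in the context does not ask for ''species'' at the root.
   Context: Independence means that, in the empirical distribution on $S$, species and salary are independent; i.e. within each nonempty salary group exactly half the creatures are elves. Gini index: for a data set $S'$ with binary label $y$, $\mathrm{Gini}(y,S')=1-\sum_{c}q_c^2$, where $q_c$ is the fraction of elements of $S'$ with label $c$. The (weighted) Gini impurity of a split of $S'$ into parts is $\sum_{T}\frac{|T|}{|S'|}\,\mathrm{Gini}(y,T)$, the sum running over the nonempty parts $T$. At the root (first level) of the binary decision tree the candidate splits of $S$ are: ''species'' (elves versus ogres), ''low salary'' (low versus medium or high), ''medium salary'' (medium versus low or high), and ''high salary'' (high versus low or medium). If all points of $S$ have the same label, the root is a leaf and no question is asked; otherwise the root asks for a candidate split with the smallest Gini impurity.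
   Formalization: When the medium fraction is exactly 1/2 and no creature has low salary, or none has high, ''species'' ties for smallest Gini impurity; there the claim is proved only if ties are not resolved in favour of ''species''. In all other cases it holds for every tie-breaking rule. *)

(* Defs.v *)
(* MathComp *)
From HB Require Import structures.
From mathcomp Require Import all_boot all_order all_algebra.

Set Implicit Arguments.
Unset Strict Implicit.
Unset Printing Implicit Defensive.

Import Order.TTheory GRing.Theory Num.Theory.
Local Open Scope ring_scope.

Variant species := Elf | Ogre.
Variant salary := Low | Medium | High.
Variant question := AskSpecies | AskSalary of salary.

Definition bool_of_species s := if s is Elf then true else false.
Definition species_of_bool b := if b then Elf else Ogre.
Lemma bool_of_speciesK : cancel bool_of_species species_of_bool.
Proof. by case. Qed.
HB.instance Definition _ := Finite.copy species (can_type bool_of_speciesK).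

Definition option_of_salary v :=
  match v with Low => Some false | Medium => None | High => Some true end.
Definition salary_of_option o :=
  match o with Some false => Low | None => Medium | Some true => High end.
Lemma option_of_salaryK : cancel option_of_salary salary_of_option.
Proof. by case. Qed.
HB.instance Definition _ := Finite.copy salary (can_type option_of_salaryK).

Definition option_of_question q :=
  if q is AskSalary v then Some v else None.
Definition question_of_option o :=
  if o is Some v then AskSalary v else AskSpecies.
Lemma option_of_questionK : cancel option_of_question question_of_option.
Proof. by case. Qed.
HB.instance Definition _ := Finite.copy question (can_type option_of_questionK).

Definition creditworthy (s : species) (v : salary) : bool :=
  match v with Low => false | Medium => s == Elf | High => true end.

Definition fraction (T : finType) (A S : {set T}) : rat := #|A|%:R / #|S|%:R.

Definition gini (T : finType) (y : T -> bool) (S : {set T}) : rat :=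
  1 - \sum_(c : bool) fraction [set x in S | y x == c] S ^+ 2.

Section Creatures.

(* A data set is a set of points of T; distinct points may carry the same
   attribute values. *)
Variables (T : finType) (sp : T -> species) (sal : T -> salary).

Definition label (x : T) : bool := creditworthy (sp x) (sal x).

Definition salary_fraction (S : {set T}) (v : salary) : rat :=
  fraction [set x in S | sal x == v] S.

Definition species_fraction (S : {set T}) (s : species) : rat :=
  fraction [set x in S | sp x == s] S.

Definition independent_attributes (S : {set T}) : Prop :=
  forall s v, fraction [set x in S | (sp x == s) && (sal x == v)] S
              = species_fraction S s * salary_fraction S v.

Definition answer (q : question) (x : T) : bool :=
  match q with AskSpecies => sp x == Elf | AskSalary v => sal x == v end.

Definition part (q : question) (S : {set T}) (b : bool) : {set T} :=
  [set x in S | answer q x == b].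

Definition gini_impurity (q : question) (S : {set T}) : rat :=
  \sum_(b : bool | part q S b != set0)
     fraction (part q S b) S * gini label (part q S b).

Definition best_questions (S : {set T}) : {set question} :=
  [set q | [forall q', gini_impurity q S <= gini_impurity q' S]].

(* The Gini criterion alone determines the root question only up to ties, so
   the tree is parameterized by the rule tb that selects one of the best
   questions.  None stands for a leaf. *)
Definition root_question (tb : {set question} -> question) (S : {set T}) :
    option question :=
  if [forall x in S, forall x' in S, label x == label x'] then None
  else Some (tb (best_questions S)).

End Creatures.

Definition tie_breaking (tb : {set question} -> question) : Prop :=
  forall Q : {set question}, Q != set0 -> tb Q \in Q.

Definition species_last (tb : {set question} -> question) : Prop :=
  forall Q : {set question}, tb Q = AskSpecies -> Q \subset [set AskSpecies].

(* Main.v *)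
(* With masses a, m, c for low, medium and high salary, independence makes every
   (species, salary) cell carry half of its salary mass, so asking for the
   species costs a(1-a) + c(1-c), while splitting off the low (resp. high) group
   leaves one pure part and costs m(m+2c) / 2(1-a) (resp. m(m+2a) / 2(1-c)).
   If m <= 1/2, splitting off the larger of the low and high groups is at least
   as good as the species question, with a tie only if m = 1/2 and the smaller
   of these groups is empty. *)

Require Import Defs.
From HB Require Import structures.
From mathcomp Require Import all_boot all_order all_algebra.
From mathcomp Require Import ring lra.

Set Implicit Arguments.
Unset Strict Implicit.
Unset Printing Implicit Defensive.

Import Order.TTheory GRing.Theory Num.Theory.
Local Open Scope ring_scope.

(** * Sums over attributes and masses of fibres *)

Lemma sum_species (R : nmodType) (F : species -> R) :
  \sum_s F s = F Elf + F Ogre.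
Proof.
by rewrite (bigD1 Elf) //= (bigD1 Ogre) //= big1 ?addr0 //; case.
Qed.

Lemma sum_salary (R : nmodType) (F : salary -> R) :
  \sum_v F v = F Low + F Medium + F High.
Proof.
rewrite (bigD1 Low) //= (bigD1 Medium) //= (bigD1 High) //= big1.
  by rewrite addr0 addrA.
by case.
Qed.

Lemma fraction_fibres (T I : finType) (f : T -> I) (A S : {set T}) :
  fraction A S = \sum_i fraction [set x in A | f x == i] S.
Proof.
rewrite /fraction -mulr_suml -natr_sum -sum1_card (partition_big f xpredT) //=.
congr (_%:R / _); apply: eq_bigr => i _; rewrite -sum1_card.
by apply: eq_bigl => x; rewrite inE.
Qed.

(** If [A] has [a] points, [t] labeled true and [f] false, then [a = t + f] turns
    [1 - (t/a)^2 - (f/a)^2] into [2tf/a^2]. For empty [A] both sides are 0, since [0^-1 = 0]. *)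
Lemma gini_part (T : finType) (y : T -> bool) (A S : {set T}) :
  A \subset S ->
  fraction A S * gini y A =
  2 * fraction [set x in A | y x == true] S
    * fraction [set x in A | y x == false] S / fraction A S.
Proof.
move=> sAS; have [->|nA] := eqVneq A set0.
  by rewrite /fraction cards0 !(mul0r, invr0, mulr0).
have nS : #|S|%:R != 0 :> rat.
  rewrite pnatr_eq0 cards_eq0; apply: contraNneq nA => S0.
  by rewrite S0 subset0 in sAS.
have {}nA : #|A|%:R != 0 :> rat by rewrite pnatr_eq0 cards_eq0.
have := fraction_fibres y A A; rewrite /gini /fraction !big_bool /= divff //.
set a := #|A|%:R; set t := _%:R; set f := (X in _ = _ + X / _) => cA.
have {}cA : a = t + f by rewrite -[LHS]mulr1 cA; field.
by rewrite cA; field; rewrite nS -cA.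
Qed.

(** * Impurities as functions of the salary masses *)

Section Impurities.

Variables (T : finType) (sp : T -> species) (sal : T -> salary) (S : {set T}).
Hypothesis hS : S != set0.

Let p := salary_fraction sal S.

Lemma fraction_self : fraction S S = 1.
Proof. by rewrite /fraction divff // pnatr_eq0 cards_eq0. Qed.

Lemma sum_salary_fraction : p Low + p Medium + p High = 1.
Proof. by rewrite -sum_salary -fraction_fibres fraction_self. Qed.

Lemma salary_fraction_ge0 v : 0 <= p v.
Proof. by rewrite /p /salary_fraction /fraction divr_ge0. Qed.

Lemma salary_fraction_eq0 v x : p v = 0 -> x \in S -> sal x != v.
Proof.
move/eqP; rewrite /p /salary_fraction /fraction mulf_eq0 invr_eq0 !pnatr_eq0.
rewrite !cards_eq0 (negbTE hS) orbF => /eqP/setP/(_ x).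
by rewrite !inE => + xS; rewrite xS /= => ->.
Qed.

Hypothesis hsize :
  #|[set x in S | sp x == Elf]| = #|[set x in S | sp x == Ogre]|.
Hypothesis hindep : independent_attributes sp sal S.

Lemma species_fraction_half s : species_fraction sp S s = 1 / 2.
Proof.
have := fraction_fibres sp S S; rewrite fraction_self sum_species.
rewrite /species_fraction /fraction hsize => E.
by case: s; rewrite ?hsize; lra.
Qed.

Lemma fraction_attributes (P : pred (species * salary)) :
  fraction [set x in S | P (sp x, sal x)] S =
  \sum_s \sum_v if P (s, v) then p v / 2 else 0.
Proof.
rewrite pair_bigA (fraction_fibres (fun x => (sp x, sal x))) /=.
apply: eq_bigr => -[s v] _ /=; case: ifP => Psv.
  have := hindep s v; rewrite species_fraction_half mul1r mulrC => <-.
  congr (fraction _ S); apply/setP => x; rewrite !inE xpair_eqE -andbA.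
  by case: eqP => [->|]; case: eqP => [->|]; rewrite ?andbF ?Psv.
rewrite (_ : [set x in _ | _] = set0) ?/fraction ?cards0 ?mul0r //.
apply/setP => x; rewrite !inE.
by case: eqP => [->|]; rewrite ?Psv !andbF.
Qed.

(** Instantiating [answer] and [label] at [fst] and [snd] makes them predicates on attribute pairs,
    so each label mass in a part is a sum over the six cells. *)
Lemma gini_impurityE q :
  gini_impurity sp sal q S =
  \sum_(b : bool)
    let m (c : bool) := \sum_s \sum_v
      if (answer fst snd q (s, v) == b) && (label fst snd (s, v) == c)
      then p v / 2 else 0 in
    2 * m true * m false / (m true + m false).
Proof.
rewrite /gini_impurity big_mkcond /=; apply: eq_bigr => b _.
have E c : fraction [set x in part sp sal q S b | label sp sal x == c] S =
    \sum_s \sum_v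
      if (answer fst snd q (s, v) == b) && (label fst snd (s, v) == c)
      then p v / 2 else 0.
  rewrite -(fraction_attributes (fun w =>
    (answer fst snd q w == b) && (label fst snd w == c))).
  congr (fraction _ S); apply/setP => x; rewrite !inE -andbA.
  by case: q.
rewrite -!E; set A := part _ _ _ _ _.
have -> : (if A != set0 then fraction A S * gini (label sp sal) A else 0) =
    fraction A S * gini (label sp sal) A.
  by case: eqP => //= ->; rewrite /fraction cards0 !mul0r.
rewrite gini_part; last by apply/subsetP => x; rewrite inE => /andP[].
by congr (_ / _); rewrite (fraction_fibres (label sp sal)) big_bool.
Qed.

Lemma gini_impurity_species :
  gini_impurity sp sal AskSpecies S =
  p Low * (1 - p Low) + p High * (1 - p High).
Proof.
rewrite gini_impurityE big_bool /= !sum_species !sum_salary /=.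
have := sum_salary_fraction; move: (p Low) (p Medium) (p High) => a m c h.
(* Eliminating [m] makes each denominator, the mass of one species, a nonzero constant. *)
have -> : m = 1 - a - c by rewrite -h; ring.
by field; rewrite (_ : _ + _ = 1) //; ring.
Qed.

Lemma gini_impurity_low :
  gini_impurity sp sal (AskSalary Low) S =
  p Medium * (p Medium + 2 * p High) / (2 * (1 - p Low)).
Proof.
rewrite gini_impurityE big_bool /= !sum_species !sum_salary /=.
have := sum_salary_fraction; move: (p Low) (p Medium) (p High) => a m c h.
have -> : 2 * (1 - a) = 2 * (m + c) by rewrite -h; ring.
rewrite !(addr0, add0r, mulr0, mul0r).
have -> : m / 2 + c / 2 + c / 2 + m / 2 = m + c by field.
(* If [m + c = 0], both sides are divisions by zero, hence 0. *)
by have [->|nz] := eqVneq (m + c) 0; [rewrite mulr0 invr0 !mulr0|field].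
Qed.

Lemma gini_impurity_high :
  gini_impurity sp sal (AskSalary High) S =
  p Medium * (p Medium + 2 * p Low) / (2 * (1 - p High)).
Proof.
rewrite gini_impurityE big_bool /= !sum_species !sum_salary /=.
have := sum_salary_fraction; move: (p Low) (p Medium) (p High) => a m c h.
have -> : 2 * (1 - c) = 2 * (m + a) by rewrite -h; ring.
rewrite !(addr0, add0r, mulr0, mul0r).
have -> : m / 2 + (a / 2 + (a / 2 + m / 2)) = m + a by field.
by have [->|nz] := eqVneq (m + a) 0; [rewrite mulr0 invr0 !mulr0|field].
Qed.

(** If one extreme salary had mass 1, the other groups would be empty and all labels equal. This
    keeps the denominators [1 - p Low] and [1 - p High] nonzero when the root is not a leaf. *)
Lemma label_salary x x' : x \in S -> x' \in S ->
  label sp sal x != label sp sal x' -> p Low != 1 /\ p High != 1.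
Proof.
move=> xS x'S; have := sum_salary_fraction.
have := (salary_fraction_ge0 Low, salary_fraction_ge0 Medium,
  salary_fraction_ge0 High) => -[[l0 m0] h0] sum1 nl.
split; apply: contraNneq nl => p1.
  have M0 : p Medium = 0 by lra.
  have H0 : p High = 0 by lra.
  have lo z : z \in S -> label sp sal z = false.
    move=> zS; rewrite /label.
    have := (salary_fraction_eq0 M0 zS, salary_fraction_eq0 H0 zS).
    by case: (sal z) => -[].
  by rewrite !lo.
have M0 : p Medium = 0 by lra.
have L0 : p Low = 0 by lra.
have hi z : z \in S -> label sp sal z = true.
  move=> zS; rewrite /label.
  have := (salary_fraction_eq0 M0 zS, salary_fraction_eq0 L0 zS).
  by case: (sal z) => -[].
by rewrite !hi.
Qed.

End Impurities.

(* Isolating the larger of the two pure salary groups, of mass a, leaves the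
   impurity on the left, and the gap between the sides is
   (4 a c (1 - a) - m ^ 2 (1 - 2 a)) / (2 (1 - a)). *)
Lemma salary_split_leif (a m c : rat) :
    0 <= m -> 0 <= c -> c <= a -> a + m + c = 1 -> m <= 1 / 2 -> a != 1 ->
  m * (m + 2 * c) / (2 * (1 - a)) <= a * (1 - a) + c * (1 - c)
    ?= iff (m == 1 / 2) && (c == 0).
Proof.
move=> m0 c0 ca sum1 m_half a_n1.
have a_lt1 : a < 1 by rewrite lt_neqAle a_n1; lra.
apply/leifP; case: ifPn => [/andP[/eqP m2 /eqP c00]|strict].
  have -> : a = 1 / 2 by lra.
  by rewrite m2 c00; apply/eqP; field.
have D0 : 0 < 2 * (1 - a) by lra.
rewrite ltr_pdivrMr // -subr_gt0.
have -> : (a * (1 - a) + c * (1 - c)) * (2 * (1 - a)) - m * (m + 2 * c) =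
    4 * a * c * (1 - a) - m ^+ 2 * (1 - 2 * a).
  have -> : m = 1 - a - c by rewrite -sum1; ring.
  by ring.
(* For [c = 0] the positive term vanishes, but [0 < m < 1/2] gives [a > 1/2], so [1 - 2a < 0]. *)
rewrite subr_gt0; have [c00|c_neq0] := eqVneq c 0.
  move: strict; rewrite c00 eqxx andbT => m_neq.
  have m_lt : m < 1 / 2 by rewrite lt_neqAle m_neq.
  have m_gt0 : 0 < m by lra.
  rewrite mulr0 mul0r pmulr_rlt0 ?exprn_gt0 //; lra.
have c_gt0 : 0 < c by rewrite lt_neqAle eq_sym c_neq0.
have [a_ge|a_lt] := lerP (1 / 2) a.
  have : m ^+ 2 * (1 - 2 * a) <= 0 by rewrite mulr_ge0_le0 ?sqr_ge0 //; lra.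
  by move/le_lt_trans; apply; rewrite !mulr_gt0 //; lra.
have k_gt0 : 0 < 1 - 2 * a by lra.
have m2_le : m ^+ 2 <= 1 / 4.
  rewrite (_ : 1 / 4 = (1 / 2) ^+ 2); last by field.
  by rewrite ler_sqr ?nnegrE.
(* Here [a + c >= 1/2] and [c <= a] give [1/4 <= a < 1/2], so [1/4 < 2a(1 - a)]; then
   [1 - 2a <= 2c], from [m <= 1/2], reaches the target. *)
apply: (@le_lt_trans _ _ (1 / 4 * (1 - 2 * a))); first by rewrite ler_pM2r.
apply: (@lt_le_trans _ _ (2 * a * (1 - a) * (1 - 2 * a))).
  by rewrite ltr_pM2r //; nra.
have -> : 2 * a * (1 - a) * (1 - 2 * a) =
    2 * (1 - 2 * a) * (a * (1 - a)) by ring.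
have -> : 4 * a * c * (1 - a) = 4 * c * (a * (1 - a)) by ring.
by rewrite ler_wpM2r ?mulr_ge0 //; lra.
Qed.

(** * The question asked at the root *)

Lemma root_questionP (T : finType) (sp : T -> species) (sal : T -> salary)
    (tb : {set question} -> question) (S : {set T}) q :
    tie_breaking tb -> root_question sp sal tb S = Some q ->
  [/\ tb (best_questions sp sal S) = q,
      forall q', gini_impurity sp sal q S <= gini_impurity sp sal q' S
    & exists x x', [/\ x \in S, x' \in S & label sp sal x != label sp sal x']].
Proof.
move=> tbP; rewrite /root_question; case: ifP => // /negbT mixed [tbq].
split=> //.
  (* Finitely many questions have a minimizer, so the tie-breaking rule chooses from a nonempty
     set. *)
  have : tb (best_questions sp sal S) \in best_questions sp sal S.
    apply: tbP; apply/set0Pn.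
    case: (@arg_minP _ _ _ AskSpecies xpredT (fun q => gini_impurity sp sal q S)).
      by [].
    move=> q0 _ q0P; exists q0; rewrite inE; apply/forallP => q'.
    exact: q0P.
  by rewrite tbq inE => /forallP.
move: mixed; rewrite negb_forall_in => /exists_inP[x xS].
by rewrite negb_forall_in => /exists_inP[x' x'S nl]; exists x, x'.
Qed.

(* The second part covers every tie-breaking rule; the excluded case, p5 = 1/2
   with p0 = 0 or p10 = 0, is an exact tie between AskSpecies and a salary
   question, and is covered by the first part. *)
Theorem theorem3 (T : finType) (sp : T -> species) (sal : T -> salary)
    (S : {set T}) (p0 p5 p10 : rat)
    (hS : S != set0)
    (hp0 : p0 = salary_fraction sal S Low)
    (hp5 : p5 = salary_fraction sal S Medium)
    (hp10 : p10 = salary_fraction sal S High)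
    (hsize : #|[set x in S | sp x == Elf]| = #|[set x in S | sp x == Ogre]|)
    (hindep : independent_attributes sp sal S)
    (hp5_le : p5 <= 1 / 2) :
  (forall tb : {set question} -> question,
     tie_breaking tb -> species_last tb ->
     root_question sp sal tb S <> Some AskSpecies)
  /\
  (p5 < 1 / 2 \/ (0 < p0 /\ 0 < p10) ->
   forall tb : {set question} -> question,
     tie_breaking tb -> root_question sp sal tb S <> Some AskSpecies).
Proof.
(* A root asking for species forces an exact tie with a salary question: [species_last] forbids
   choosing species then, and the strict hypothesis excludes the tie. *)
have best tb : tie_breaking tb ->
    root_question sp sal tb S = Some AskSpecies ->
  [/\ tb (best_questions sp sal S) = AskSpecies,
      ~ (p5 < 1 / 2 \/ 0 < p0 /\ 0 < p10)
    & exists v, AskSalary v \in best_questions sp sal S].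
  move=> tbP /(root_questionP tbP)[tbE min_sp [x [x' [xS x'S nl]]]].
  have := sum_salary_fraction sal hS; rewrite -hp0 -hp5 -hp10 => sum1.
  have := label_salary hS xS x'S nl; rewrite -hp0 -hp10 => -[n0 n10].
  have := (salary_fraction_ge0 sal S Low, salary_fraction_ge0 sal S Medium,
    salary_fraction_ge0 sal S High); rewrite -hp0 -hp5 -hp10 => -[[p00 p50] p100].
  have [v le_v] : exists v, gini_impurity sp sal (AskSalary v) S
      <= gini_impurity sp sal AskSpecies S
        ?= iff (p5 == 1 / 2) && ((p0 == 0) || (p10 == 0)).
    have [le_10_0|lt_0_10] := lerP p10 p0.
      exists Low; rewrite gini_impurity_low // gini_impurity_species //.
      rewrite -hp0 -hp5 -hp10.
      have := salary_split_leif p50 p100 le_10_0 sum1 hp5_le n0.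
      congr (Order.leif _ _ (_ && _)); case: (eqVneq p0 0) => //= p00'.
      by apply/eqP; lra.
    exists High; rewrite gini_impurity_high // gini_impurity_species //.
    rewrite -hp0 -hp5 -hp10 [X in _ <= X ?= iff _]addrC.
    have sum1' : p10 + p5 + p0 = 1 by rewrite -sum1; ring.
    have := salary_split_leif p50 p00 (ltW lt_0_10) sum1' hp5_le n10.
    by rewrite [X in _ || X](gt_eqF (le_lt_trans p00 lt_0_10)) orbF.
  split=> //.
    have : (p5 == 1 / 2) && ((p0 == 0) || (p10 == 0)).
      (* Minimality of the species question is the reverse inequality, hence the equality case. *)
      by rewrite -(ge_leif le_v) min_sp.
    by move=> /andP[/eqP-> /orP[]/eqP->] [|[]]; rewrite !ltxx.
  exists v; rewrite inE; apply/forallP => q'.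
  by rewrite (le_trans le_v).
split=> [tb tbP tb_last /(best _ tbP)[tbE _ [v]]|strict tb tbP /(best _ tbP)[]//].
by move/(subsetP (tb_last _ tbE)); rewrite inE.
Qed.
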